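(* Let $K$ be a nonempty compact polytope in a finite-dimensional Euclidean space, let $T_K:=\operatorname{lin}(K-K)$, and let $\Phi(x)=Lx+a$, with $L$ linear and $a$ a fixed vector, satisfy $$\langle Lh,h\rangle\ge\mu\|h\|^2\qquad\text{for all }h\in T_K$$ for some $\mu>0$. Suppose that the solution $x^*\in K$ of the variational inequality $$\langle\Phi(x^* ),s-x^*\rangle\ge0\qquad\text{for all }s\in K$$ belongs to $\operatorname{relint}K$. Then there is a constant $C=C(K,L,x^* )$, depending only on $K,L,x^*$ (in particular independent of $x_0$, the oracle choices and the error sequence below), such that the following holds. Let $(\delta_k)_{k\ge0}$ be a nonnegative sequence with $\overline B:=\sup_{k\ge1}k\delta_k<\infty$, let $x_0\in K$, and let, for all integers $k\ge0$, $$x_{k+1}=x_k+\frac1{k+1}(s_k-x_k),\qquad s_k\in\operatorname{vert}(K),\qquad \langle\Phi(x_k),s_k\rangle\le\min_{s\in K}\langle\Phi(x_k),s\rangle+\delta_k.$$ Then $$\|x_k-x^*\|\le\frac{C(1+\overline B)}{k}\qquad\text{for all integers }k\ge1.$$ For an exact oracle ($\delta_k=0$ for all $k$), one may take $\overline B=0$.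
   Context: $\operatorname{lin}(K-K)$ is the linear span of $\{x-y:x,y\in K\}$; $\operatorname{vert}(K)$ is the set of vertices of $K$; $\operatorname{relint}$ is the relative interior. *)

(* Defs.v *)
From HB Require Import structures.
From mathcomp Require Import all_boot all_order all_algebra.
From mathcomp Require Import boolp classical_sets cardinality reals.

Set Implicit Arguments.
Unset Strict Implicit.
Unset Printing Implicit Defensive.

Import Order.TTheory GRing.Theory Num.Theory.
Local Open Scope classical_set_scope.
Local Open Scope ring_scope.

Section Euclidean.
Context {R : realType} {n : nat}.
Implicit Types (u v x y : 'rV[R]_n) (A K : set 'rV[R]_n).

Definition dotp u v : R := \sum_(i < n) u 0 i * v 0 i.

(* The norm `|u| that the library puts on 'rV[R]_n is the sup norm. *)
Definition enorm u : R := Num.sqrt (dotp u u).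

Definition lin_span A : set 'rV[R]_n :=
  [set x | exists (m : nat) (p : 'I_m -> 'rV[R]_n) (c : 'I_m -> R),
     (forall i, A (p i)) /\ x = \sum_(i < m) c i *: p i].

Definition aff_hull A : set 'rV[R]_n :=
  [set x | exists (m : nat) (p : 'I_m -> 'rV[R]_n) (c : 'I_m -> R),
     [/\ forall i, A (p i), \sum_(i < m) c i = 1
       & x = \sum_(i < m) c i *: p i]].

Definition conv_hull A : set 'rV[R]_n :=
  [set x | exists (m : nat) (p : 'I_m -> 'rV[R]_n) (c : 'I_m -> R),
     [/\ forall i, A (p i), forall i, 0 <= c i, \sum_(i < m) c i = 1
       & x = \sum_(i < m) c i *: p i]].

(* Compactness is automatic; the empty set is allowed. *)
Definition polytope K := exists2 F, finite_set F & K = conv_hull F.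

Definition tangent_space K : set 'rV[R]_n :=
  lin_span [set h | exists x y, [/\ K x, K y & h = x - y]].

(* Vertices as extreme points. *)
Definition vert K : set 'rV[R]_n :=
  [set v | K v /\ forall (x y : 'rV[R]_n) (t : R), K x -> K y -> 0 < t < 1 ->
     v = t *: x + (1 - t) *: y -> x = v /\ y = v].

Definition relint K : set 'rV[R]_n :=
  [set x | K x /\ exists2 r : R, 0 < r &
     forall y, aff_hull K y -> enorm (y - x) < r -> K y].

Definition vi_solution (Phi : 'rV[R]_n -> 'rV[R]_n) K x :=
  K x /\ forall s, K s -> 0 <= dotp (Phi x) (s - x).

(* For K nonempty and compact this infimum is attained, i.e. it is
   min_(s in K) <g, s>. *)
Definition lin_min K (g : 'rV[R]_n) : R := inf [set dotp g s | s in K].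

(* x and s are the iterates and the oracle answers; delta is the sequence of
   oracle errors. *)
Definition fw_trajectory (Phi : 'rV[R]_n -> 'rV[R]_n) K
    (delta : nat -> R) (x s : nat -> 'rV[R]_n) :=
  K (x 0%N) /\ forall k : nat,
    [/\ vert K (s k),
        dotp (Phi (x k)) (s k) <= lin_min K (Phi (x k)) + delta k
      & x k.+1 = x k + k.+1%:R^-1 *: (s k - x k)].

End Euclidean.

Definition weighted_errors {R : realType} (delta : nat -> R) : set R :=
  [set k%:R * delta k | k in [set k : nat | (1 <= k)%N]].

(* Main.v *)
Require Import Defs.
From HB Require Import structures.
From mathcomp Require Import all_boot all_order all_algebra.
From mathcomp Require Import boolp classical_sets cardinality reals.
From mathcomp Require Import zify ring lra.

Set Implicit Arguments.
Unset Strict Implicit.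
Unset Printing Implicit Defensive.

Import Order.TTheory GRing.Theory Num.Theory.
Local Open Scope classical_set_scope.
Local Open Scope ring_scope.

(** With the step 1/(k+1), the sums y k = k (x k - xstar) satisfy
    y (k+1) = y k + v k with v k = s k - xstar, so the claim is exactly that y
    stays bounded by a multiple of E = 1 + B. Because xstar is relatively
    interior, Phi xstar vanishes on the tangent space (vi_relint); hence v k
    almost maximizes the linear form - <L (y k), .> over K - xstar, with error
    k delta_k <= B (trajectory_greedy). Call the value of this form at v k the
    lead at time k. Testing against the point of K in the direction - y k gives
    kappa |y k| <= lead k + E, so it suffices to bound the lead.

    For symmetric L the function <L y, y> decreases whenever y is large. In
    general it need not, and the lead itself may increase while the oracle
    alternates between nearly tied vertices; only its average over time
    decreases. The average is controlled by induction on the number of vertices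
    that occur in a time interval (drift), which is where the finiteness of the
    vertex set enters. Consider [a, b] and a window length m proportional to E.
    - If every vertex of [a, b] occurs again in its last m steps, all of them
      are tied at time b up to O(m) (equalized). Averaging over the vertices
      played, the lead changes from a to b by at most - (b - a) <L u, u> + O(E),
      where u is the mean of the v j (equalized_drop). Since u has a large
      product with L (y b), it is bounded away from 0, and so is <L u, u>.
    - Otherwise the last m steps use fewer vertices. By induction the lead
      drops there by c1 m - O(E), at least c1 m / 2 for a suitable m, and the
      argument is repeated on [a, b - m].
    Thus the lead grows by at most O(E) while it exceeds a suitable multiple of
    E (bounded_lead). All constants depend on L, K and xstar only. *)

(** * Near-greedy play against an accumulated score *)

Section GreedyPlay.
Context {R : realType} {T : finType}.
Implicit Types (M : T -> T -> R) (lab : nat -> T) (a b k s t m : nat).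

(** For vectors v_z indexed by z and M y z = <L v_y, v_z>, this is
    - <L y, v_z> with y the sum of the first k vectors played. *)
Definition score M lab k (z : T) : R := - \sum_(0 <= j < k) M (lab j) z.

Definition lead M lab k : R := score M lab k (lab k).

(** What remains of <L U, U> >= mu |U|^2 for a sum U of vectors played: if each
    of them has a score at least half of a non-negligible lead, then U has
    length at least proportional to the number of its terms, as its product
    with the vector L (y k) is. *)
Definition coercive_play M lab (c E : R) := forall k s t, (s <= t)%N ->
  E <= lead M lab k ->
  (forall j, (s <= j < t)%N -> lead M lab k / 2 <= score M lab k (lab j)) ->
  c * (t - s)%:R ^+ 2 <=
    \sum_(s <= i < t) \sum_(s <= j < t) M (lab i) (lab j).

Record play M (c E : R) lab : Prop := Play {
  play_greedy : forall k z, score M lab k z <= lead M lab k + E;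
  play_coercive : coercive_play M lab c E }.

Definition labels lab a b : {set T} :=
  [set lab (i : 'I_b.+1) | i in [pred i : 'I_b.+1 | (a <= i)%N]].

Lemma labelsP lab a b z :
  reflect (exists2 t, (a <= t <= b)%N & z = lab t) (z \in labels lab a b).
Proof.
apply: (iffP imsetP) => [[i /= ai ->]|[t /andP[at_ tb] ->]].
  by exists i => //; move: ai; rewrite inE => ->; rewrite -ltnS ltn_ord.
by exists (Ordinal (tb : (t < b.+1)%N)).
Qed.

Lemma labels_subl lab a a' b : (a <= a')%N ->
  labels lab a' b \subset labels lab a b.
Proof.
move=> aa'; apply/fintype.subsetP => z /labelsP[t /andP[a't tb] ->].
by apply/labelsP; exists t; rewrite // (leq_trans aa' a't).
Qed.

Lemma labels_subr lab a b b' : (b <= b')%N ->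
  labels lab a b \subset labels lab a b'.
Proof.
move=> bb'; apply/fintype.subsetP => z /labelsP[t /andP[a't tb] ->].
by apply/labelsP; exists t; rewrite // a't (leq_trans tb bb').
Qed.

Lemma score_split M lab s t z : (s <= t)%N ->
  score M lab t z = score M lab s z - \sum_(s <= j < t) M (lab j) z.
Proof. by move=> st; rewrite /score (big_cat_nat (leq0n s) st) /= opprD. Qed.

Lemma score_drift M (D : R) lab s t z : (forall y w, `|M y w| <= D) ->
  (s <= t)%N -> `|score M lab t z - score M lab s z| <= D * (t - s)%:R.
Proof.
move=> MD st; rewrite (score_split M lab z st) addrC addKr normrN.
apply: le_trans (ler_norm_sum _ _ _) _.
rewrite mulr_natr -sumr_const_nat; exact: ler_sum.
Qed.

(** A choice made at time t beats, up to E, what will be chosen at b; scores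
    move by at most D per step, once for each of the two choices. *)
Lemma equalized M (D c E : R) lab t b : (forall y w, `|M y w| <= D) ->
  play M c E lab -> (t <= b)%N ->
  lead M lab b - (2 * D * (b - t)%:R + E) <= score M lab b (lab t).
Proof.
move=> MD pl tb.
have := score_drift lab (lab t) MD tb; have := score_drift lab (lab b) MD tb.
have := play_greedy pl t (lab b).
rewrite !ler_norml /lead => H1 /andP[H2 H3] /andP[H4 H5].
lra.
Qed.

Lemma lead_succ M (D c E : R) lab k : (forall y w, `|M y w| <= D) ->
  play M c E lab -> lead M lab k.+1 <= lead M lab k + E + D.
Proof.
move=> MD pl; have := score_drift lab (lab k.+1) MD (leqnSn k).
have := play_greedy pl k (lab k.+1).
rewrite !ler_norml subSnn mulr1 /lead => H1 /andP[H2 H3]; lra.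
Qed.

(** The scores at b of the choices made in [a, b) are summed: at time a they are
    at most lead a + E each, and the increments add up to minus the double sum
    of M, a full square and not a triangular sum, so that an antisymmetric part
    of M does not contribute. *)
Lemma equalized_drop M (c E eta : R) lab a b : play M c E lab ->
  (a <= b)%N -> 0 <= eta -> eta <= lead M lab b / 2 ->
  0 <= E -> E <= lead M lab b ->
  (forall j, (a <= j < b)%N -> lead M lab b - eta <= score M lab b (lab j)) ->
  lead M lab b <= lead M lab a - c * (b - a)%:R + (E + eta).
Proof.
move=> pl ab eta0 etab E0 Eb near.
case: (eqVneq a b) => [->|neq_ab]; first by rewrite subnn mulr0; lra.
have n_gt0 : 0 < (b - a)%:R :> R by rewrite ltr0n subn_gt0 ltn_neqAle neq_ab.
have H j : (a <= j < b)%N -> lead M lab b / 2 <= score M lab b (lab j).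
  by move=> /near; lra.
have coer := play_coercive pl ab Eb H.
have low : (b - a)%:R * (lead M lab b - eta) <= \sum_(a <= j < b) score M lab b (lab j).
  rewrite mulr_natl -sumr_const_nat ler_sum_nat // => j /near //.
have up : \sum_(a <= j < b) score M lab a (lab j) <= (b - a)%:R * (lead M lab a + E).
  rewrite mulr_natl -sumr_const_nat; apply: ler_sum => j _; exact: play_greedy pl _ _.
have split : \sum_(a <= j < b) score M lab b (lab j) =
    \sum_(a <= j < b) score M lab a (lab j) -
    \sum_(a <= i < b) \sum_(a <= j < b) M (lab i) (lab j).
  rewrite exchange_big /= -sumrB; apply: eq_bigr => j _.
  exact: score_split.
have : (b - a)%:R * (lead M lab b - eta) <=
    (b - a)%:R * (lead M lab a + E - c * (b - a)%:R).
  nra.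
rewrite ler_pM2l //; lra.
Qed.

(** The three constants depend on M, c and q alone, and all error terms scale
    with E; this is what makes the final bound linear in 1 + B. The rate is
    halved, and capped by c, when the number of labels grows by one, to pay for the error
    C1 * E of the windows to which the induction hypothesis is applied. *)
Lemma drift M (D c : R) q : 0 < c -> 0 <= D -> (forall y w, `|M y w| <= D) ->
  exists c' C A : R, [/\ 0 < c', 0 <= C, 1 <= A &
    forall lab (E : R), 1 <= E -> play M c E lab -> forall a b, (a <= b)%N ->
      (#|labels lab a b| <= q)%N ->
      (forall t, (a <= t <= b)%N -> A * E <= lead M lab t) ->
      lead M lab b <= lead M lab a - c' * (b - a)%:R + C * E].
Proof.
move=> c0 D0 MD; elim: q => [|q [c1 [C1 [A1 [c10 C10 A11 IH]]]]].
  exists 1, 0, 1; split=> // lab E _ _ a b ab.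
  rewrite leqn0 cards_eq0 => /eqP/setP/(_ (lab a)); rewrite inE => /negP[].
  by apply/labelsP; exists a; rewrite ?leqnn.
pose r : R := 2 * C1 / c1 + 1.
have r1 : 1 <= r by rewrite /r lerDr divr_ge0 ?mulr_ge0 // ltW.
pose h : R := 2 * D * r + 1.
have h1 : 1 <= h by rewrite /h lerDr !mulr_ge0 //; lra.
exists (Num.min (c1 / 2) c), (1 + h), (A1 + 2 * h).
split; [by rewrite lt_min c0 andbT; lra | lra | lra |].
move=> lab E E1 pl a b; have [N] := ubnP (b - a)%N.
elim: N a b => // N IHN a b bN ab card big.
(* m is just long enough for half of the drop c1 * m to absorb C1 * E. *)
have [m [m_gt0 m_lo m_hi]] : exists m : nat,
    [/\ (0 < m)%N, C1 * E <= c1 / 2 * m%:R & m%:R <= r * E].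
  have z0 : 0 <= 2 * C1 / c1 * E.
    by rewrite !mulr_ge0 ?invr_ge0 //; lra.
  have /andP[lo hi] := truncn_itv z0.
  exists (Num.truncn (2 * C1 / c1 * E)).+1; split=> //.
    have -> : C1 * E = c1 / 2 * (2 * C1 / c1 * E) by field; lra.
    by rewrite ler_pM2l; [exact: ltW | lra].
  by rewrite -[_.+1%:R]natr1 /r; lra.
have mE : 2 * D * m%:R + E <= h * E.
  have : 2 * D * m%:R <= 2 * D * (r * E) by rewrite ler_wpM2l //; lra.
  rewrite /h; lra.
have hE0 : 0 <= h * E by rewrite mulr_ge0; lra.
have bigb : (A1 + 2 * h) * E <= lead M lab b by apply: big; rewrite ab leqnn.
have A1E : E <= A1 * E by rewrite ler_peMl //; lra.
(* The window is the last m steps of [a, b], or all of [a, b] if it is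
   shorter; in that case the inclusion holds trivially. *)
have [all_recent|] := boolP (labels lab a b \subset labels lab (maxn a (b - m)) b).
  have : lead M lab b <= lead M lab a - c * (b - a)%:R + (E + h * E).
    apply: (equalized_drop pl) => //; [lra | lra | lra |].
    move=> j /andP[aj jb].
    have /(fintype.subsetP all_recent)/labelsP[t] : lab j \in labels lab a b.
      by apply/labelsP; exists j; rewrite // aj ltnW.
    rewrite geq_max => /andP[/andP[at_ bmt] tb] ->.
    apply: le_trans (equalized MD pl tb); rewrite lerD2l lerN2.
    apply: le_trans mE; rewrite lerD2r.
    apply: ler_wpM2l; first lra.
    rewrite ler_nat.
    by clear -bmt; lia.
  have : Num.min (c1 / 2) c * (b - a)%:R <= c * (b - a)%:R.
    by rewrite ler_wpM2r // ge_min lexx orbT.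
  lra.
have [abm|abm] := leqP b (a + m).
  have -> : maxn a (b - m) = a by clear -ab abm; lia.
  by rewrite subxx.
have -> : maxn a (b - m) = (b - m)%N by clear -abm; lia.
move=> missing.
have less : (#|labels lab (b - m) b| <= q)%N.
  rewrite -ltnS; apply: leq_trans card; apply: proper_card.
  rewrite properE missing andbT labels_subl //; clear -abm; lia.
have := IH lab E E1 pl (b - m)%N b (leq_subr _ _) less.
have -> : (b - (b - m) = m)%N by clear -abm; lia.
have big1 t : (a <= t <= b)%N -> A1 * E <= lead M lab t.
  by move=> /big; nra.
move=> /(_ _) H.
have {}H : lead M lab b <= lead M lab (b - m) - c1 * m%:R + C1 * E.
  by apply: H => t ht; apply: big1; clear -abm ht; lia.
have : lead M lab (b - m) <=
    lead M lab a - Num.min (c1 / 2) c * (b - m - a)%:R + (1 + h) * E.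
  apply: IHN; [clear -bN abm m_gt0; lia | clear -abm; lia | | ].
    by apply: leq_trans card; apply/subset_leq_card/labels_subr/leq_subr.
  by move=> t ht; apply: big; clear -abm ht; lia.
have -> : (b - a)%:R = (b - m - a)%:R + m%:R :> R.
  by rewrite -natrD; congr _%:R; clear -abm; lia.
have : Num.min (c1 / 2) c * m%:R <= c1 / 2 * m%:R.
  by rewrite ler_wpM2r // ge_min lexx.
lra.
Qed.

(** Go back to the last time at which the lead was below A * E, or to time 0,
    where it vanishes: one step raises the lead by at most E + D, and from then
    on drift allows a further gain of C * E only. *)
Lemma bounded_lead M (D c : R) : 0 < c -> 0 <= D -> (forall y w, `|M y w| <= D) ->
  exists2 P : R, 0 <= P & forall lab (E : R), 1 <= E -> play M c E lab ->
    forall k, lead M lab k <= P * E.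
Proof.
move=> c0 D0 MD; have [c' [C [A [c'0 C0 A1 dr]]]] := drift #|T| c0 D0 MD.
exists (A + D + 1 + C); first lra.
move=> lab E E1 pl k.
have DE : 0 <= D * E - D by rewrite subr_ge0 ler_peMr.
have CE : 0 <= C * E by rewrite mulr_ge0 //; lra.
have AE : 0 <= A * E by rewrite mulr_ge0 //; lra.
have [small|[a [ak la big]]] : lead M lab k < A * E \/
    exists a, [/\ (a <= k)%N, lead M lab a <= (A + D + 1) * E &
      forall t, (a <= t <= k)%N -> A * E <= lead M lab t].
- elim: k => [|k IHk].
    have l0 : lead M lab 0 = 0 by rewrite /lead /score big_geq ?oppr0.
    by left; rewrite l0; nra.
  have [|big1] := ltP (lead M lab k.+1) (A * E); [by left | right].
  case: IHk => [small|[a [ak la big]]].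
    exists k.+1; split=> //; first by have := lead_succ k MD pl; lra.
    by move=> t; rewrite -eqn_leq => /eqP <-.
  exists a; split; [exact: leqW | by [] |] => t.
  case: (eqVneq t k.+1) => [->//|neq] /andP[at_ tk].
  apply: big; clear -at_ tk neq; lia.
- lra.
have := dr lab E E1 pl a k ak (max_card _) big.
have : 0 <= c' * (k - a)%:R by rewrite mulr_ge0 // ltW.
lra.
Qed.

End GreedyPlay.

(** * Euclidean and convex geometry of the trajectory *)

Section Geometry.
Context {R : realType} {n : nat}.
Implicit Types (u v w x y z : 'rV[R]_n) (K F : set 'rV[R]_n).

Lemma dotpC u v : dotp u v = dotp v u.
Proof. by apply: eq_bigr => i _; rewrite mulrC. Qed.

Lemma dotpDl u v w : dotp (u + v) w = dotp u w + dotp v w.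
Proof. by rewrite /dotp -big_split; apply: eq_bigr => i _; rewrite mxE mulrDl. Qed.

Lemma dotpZl (a : R) u w : dotp (a *: u) w = a * dotp u w.
Proof. by rewrite /dotp mulr_sumr; apply: eq_bigr => i _; rewrite mxE mulrA. Qed.

Lemma dotp0l w : dotp 0 w = 0.
Proof. by rewrite -(scale0r w) dotpZl mul0r. Qed.

Lemma dotp_suml (I : Type) (r : seq I) (f : I -> 'rV[R]_n) w :
  dotp (\sum_(i <- r) f i) w = \sum_(i <- r) dotp (f i) w.
Proof.
elim: r => [|i r IH]; first by rewrite !big_nil dotp0l.
by rewrite !big_cons dotpDl IH.
Qed.

Lemma dotpDr u v w : dotp w (u + v) = dotp w u + dotp w v.
Proof. by rewrite !(dotpC w) dotpDl. Qed.

Lemma dotpZr (a : R) u w : dotp w (a *: u) = a * dotp w u.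
Proof. by rewrite !(dotpC w) dotpZl. Qed.

Lemma dotpNr u w : dotp w (- u) = - dotp w u.
Proof. by rewrite -scaleN1r dotpZr mulN1r. Qed.

Lemma dotp_sumr (I : Type) (r : seq I) (f : I -> 'rV[R]_n) w :
  dotp w (\sum_(i <- r) f i) = \sum_(i <- r) dotp w (f i).
Proof. by rewrite dotpC dotp_suml; apply: eq_bigr => i _; rewrite dotpC. Qed.

Lemma dotp_ge0 u : 0 <= dotp u u.
Proof. by apply: sumr_ge0 => i _; rewrite -expr2 sqr_ge0. Qed.

Lemma enorm_ge0 u : 0 <= enorm u.
Proof. exact: sqrtr_ge0. Qed.

Lemma sqr_enorm u : enorm u ^+ 2 = dotp u u.
Proof. by rewrite sqr_sqrtr // dotp_ge0. Qed.

Lemma enormZ (a : R) u : enorm (a *: u) = `|a| * enorm u.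
Proof. by rewrite /enorm dotpZl dotpZr mulrA -expr2 sqrtrM ?sqr_ge0 // sqrtr_sqr. Qed.

Lemma coord_le_enorm u i : `|u 0 i| <= enorm u.
Proof.
rewrite -sqrtr_sqr ler_wsqrtr // /dotp (bigD1 i) //= -expr2 lerDl.
by apply: sumr_ge0 => j _; rewrite -expr2 sqr_ge0.
Qed.

Lemma bilinear_bound (L : {linear 'rV[R]_n -> 'rV[R]_n}) :
  exists2 l : R, 0 < l & forall u v, `|dotp (L u) v| <= l * enorm u * enorm v.
Proof.
pose A := lin1_mx L.
pose l := \sum_(i < n) \sum_(j < n) `|A j i|.
have l0 : 0 <= l by apply: sumr_ge0 => i _; apply: sumr_ge0.
exists (l + 1); first lra.
move=> u v; apply: (@le_trans _ _ (l * enorm u * enorm v)); last first.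
  by rewrite -!mulrA ler_wpM2r ?mulr_ge0 ?enorm_ge0 //; lra.
rewrite /dotp -(mul_rV_lin1 L) -mulrA mulr_suml.
apply: le_trans (ler_norm_sum _ _ _) _; apply: ler_sum => i _.
rewrite mxE mulr_suml mulr_suml.
apply: le_trans (ler_norm_sum _ _ _) _; apply: ler_sum => j _.
by rewrite !normrM -/A [`|u 0 j| * _]mulrC -mulrA !ler_pM ?mulr_ge0 ?coord_le_enorm.
Qed.

Lemma sub_conv_hull F : F `<=` conv_hull F.
Proof.
move=> z Fz; exists 1%N, (fun=> z), (fun=> 1); split=> //.
  by rewrite big_ord1.
by rewrite big_ord1 scale1r.
Qed.

(** An extreme point v = sum c_i p_i has some c_i > 0; splitting the sum into
    c_i p_i and 1 - c_i times a point of the hull forces p_i = v. *)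
Lemma vert_conv_hull F : vert (conv_hull F) `<=` F.
Proof.
move=> v [[m [p [c [Fp c0 c1 vE]]]] ext].
have [i ci] : exists i, 0 < c i.
  apply: contrapT => no; have : \sum_(i < m) c i <= 0.
    apply: sumr_le0 => i _; rewrite leNgt; apply/negP => ci; apply: no; by exists i.
  by rewrite c1 ler10.
have rest : \sum_(j < m | j != i) c j = 1 - c i.
  by move: c1; rewrite (bigD1 i) //= => <-; rewrite [RHS]addrC addKr.
have [ci1|ci1] := eqVneq (c i) 1.
  have c_eq0 j : j != i -> c j = 0.
    move=> ji; apply: (psumr_eq0P (P := fun j => j != i)) ji => //.
    by rewrite rest ci1 subrr.
  rewrite vE (bigD1 i) //= ci1 scale1r big1 ?addr0 // => j /c_eq0 ->.
  by rewrite scale0r.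
have rest0 : 0 <= 1 - c i by rewrite -rest; apply: sumr_ge0.
have lt1 : c i < 1 by rewrite lt_neqAle ci1 -subr_ge0.
pose w := \sum_(j < m) (if j == i then 0 else c j / (1 - c i)) *: p j.
have Kw : conv_hull F w.
  exists m, p, (fun j => if j == i then 0 else c j / (1 - c i)); split=> //.
    by move=> j; case: ifP => // _; rewrite divr_ge0.
  rewrite (bigD1 i) //= eqxx add0r.
  rewrite (eq_bigr (fun j => c j / (1 - c i))) => [|j /negPf -> //].
  by rewrite -mulr_suml rest divff // subr_eq0 eq_sym.
have vE' : v = c i *: p i + (1 - c i) *: w.
  rewrite vE (bigD1 i) //=; congr (_ + _).
  rewrite /w scaler_sumr [RHS](bigD1 i) //= eqxx scale0r scaler0 add0r.
  apply: eq_bigr => j /negPf ->; rewrite scalerA mulrCA divff ?mulr1 //.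
  by rewrite subr_eq0 eq_sym.
have ci01 : 0 < c i < 1 by rewrite ci.
by have [<- _] := ext _ _ _ (sub_conv_hull (Fp i)) Kw ci01 vE'.
Qed.

(** The infimum of an unbounded set being a default value, the content is that
    a linear form is bounded below on a polytope. *)
Lemma lin_min_le K g z : polytope K -> K z -> lin_min K g <= dotp g z.
Proof.
move=> [F /finite_seqP[fs FE] KE] Kz; apply: ge_inf; last by exists z.
pose b := \sum_(f <- fs) `|dotp g f|.
exists (- b) => _ [y Ky <-].
move: Ky; rewrite KE => -[m [p [c [Fp c0 c1 ->]]]].
rewrite dotp_sumr -[- b]mul1r -c1 mulr_suml; apply: ler_sum => i _.
rewrite dotpZr ler_wpM2l // lerNl.
have pi_fs : p i \in fs by have := Fp i; rewrite FE.
apply: (@le_trans _ _ `|dotp g (p i)|); first by rewrite -normrN ler_norm.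
by rewrite /b (big_rem _ pi_fs) /= lerDl; apply: sumr_ge0.
Qed.

Lemma tangent_sum K xs (s : nat -> 'rV[R]_n) a b : (forall j, K (s j)) -> K xs ->
  tangent_space K (\sum_(a <= j < b) (s j - xs)).
Proof.
move=> Ks Kxs; exists (b - a)%N, (fun i => s (i + a)%N - xs), (fun=> 1).
split=> [i|]; first by exists (s (i + a)%N), xs.
rewrite -{1}[a]add0n big_addn big_mkord.
by apply: eq_bigr => i _; rewrite scale1r.
Qed.

(** xs can be moved a little against any direction s - xs; a sum of such
    directions is needed because the relevant one is the vector y k, which is
    not known to be a single difference of points of K. *)
Lemma relint_reflect K xs : relint K xs -> exists2 rho : R, 0 < rho &
  forall (s : nat -> 'rV[R]_n) k (t : R), (forall j, K (s j)) ->
    `|t| * enorm (\sum_(0 <= j < k) (s j - xs)) <= rho ->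
    K (xs - t *: \sum_(0 <= j < k) (s j - xs)).
Proof.
move=> [Kxs [r r0 inK]]; exists (r / 2); first lra.
move=> s k t Ks small; apply: inK; last first.
  rewrite addrC addKr -scaleNr enormZ normrN; lra.
(* Index 0 carries xs, with the weight that makes the total 1. *)
exists k.+1, (fun i => if unlift ord0 i is Some j then s j else xs),
  (fun i => if unlift ord0 i is Some j then - t else 1 + k%:R * t).
split=> [i||].
- by case: unlift.
- rewrite big_ord_recl unlift_none.
  rewrite (eq_bigr (fun=> - t)) => [|i _]; last by rewrite liftK.
  by rewrite sumr_const card_ord -mulr_natl; ring.
- rewrite big_ord_recl unlift_none.
  rewrite (eq_bigr (fun i : 'I_k => - t *: s i)) => [|i _]; last by rewrite liftK.
  rewrite -scaler_sumr big_mkord sumrB sumr_const card_ord -scaler_nat.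
  rewrite scalerBr scalerA scalerDl scale1r scaleNr opprB addrA; congr (_ - _).
  by rewrite [t * _]mulrC.
Qed.

(** A linear form that is nonnegative on K - xs is also nonpositive there, since
    xs - t (z - xs) belongs to K for small t > 0. *)
Lemma vi_relint K (Phi : 'rV[R]_n -> 'rV[R]_n) xs z : relint K xs ->
  vi_solution Phi K xs -> K z -> dotp (Phi xs) (z - xs) = 0.
Proof.
move=> ri [_ vi] Kz; apply: le_anti; rewrite vi // andbT.
have [rho rho0 refl] := relint_reflect ri.
pose t := rho / (1 + enorm (z - xs)).
have e0 := enorm_ge0 (z - xs).
have t0 : 0 < t by rewrite divr_gt0 //; lra.
have small : `|t| * enorm (z - xs) <= rho.
  rewrite gtr0_norm // /t mulrAC ler_pdivrMr; last lra.
  by rewrite ler_wpM2l; lra.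
have := refl (fun=> z) 1%N t (fun=> Kz); rewrite big_nat1 => /(_ small)/vi.
by rewrite [in dotp _ _]addrC addKr dotpNr dotpZr oppr_ge0 pmulr_rle0.
Qed.

Lemma trajectory_sum (Phi : 'rV[R]_n -> 'rV[R]_n) K delta (x s : nat -> 'rV[R]_n) xs k :
  fw_trajectory Phi K delta x s ->
  k%:R *: (x k - xs) = \sum_(0 <= j < k) (s j - xs).
Proof.
move=> [_ tr]; elim: k => [|k IH]; first by rewrite scale0r big_geq.
have [_ _ ->] := tr k; rewrite big_nat_recr //= -IH.
rewrite addrAC scalerDr scalerA divff ?pnatr_eq0 // scale1r.
by rewrite -natr1 scalerDl scale1r -addrA; congr (_ + _); rewrite addrC subrKA.
Qed.

(** Multiplying the oracle inequality by k turns x k - xs into the sum of the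
    past directions; Phi xs drops out by vi_relint, and with it the vector a. *)
Lemma trajectory_greedy K (L : {linear 'rV[R]_n -> 'rV[R]_n}) (a xs : 'rV[R]_n) delta
    (x s : nat -> 'rV[R]_n) k z :
  polytope K -> relint K xs -> vi_solution (fun x => L x + a) K xs ->
  fw_trajectory (fun x => L x + a) K delta x s -> K z ->
  dotp (L (\sum_(0 <= j < k) (s j - xs))) (s k - xs) <=
  dotp (L (\sum_(0 <= j < k) (s j - xs))) (z - xs) + k%:R * delta k.
Proof.
move=> pK ri vi tr Kz; rewrite -(trajectory_sum xs k tr) linearZ /= !dotpZl -mulrDr.
rewrite ler_wpM2l //.
have [vs opt _] := tr.2 k; have Ks : K (s k) by case: vs.
have PhiE u : K u ->
    dotp (L (x k) + a) u = dotp (L (x k - xs)) (u - xs) + dotp (L (x k) + a) xs.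
  move=> Ku; have -> : dotp (L (x k) + a) u =
      dotp (L (x k) + a) (u - xs) + dotp (L (x k) + a) xs by rewrite -dotpDr subrK.
  have {1}-> : L (x k) + a = L (x k - xs) + (L xs + a).
    by rewrite linearB addrA subrK.
  by rewrite [dotp (_ + (_ + _)) _]dotpDl (vi_relint ri vi Ku) addr0.
have := lin_min_le (L (x k) + a) pK Kz.
move: opt; rewrite (PhiE _ Ks) (PhiE _ Kz); lra.
Qed.

End Geometry.

(** * The rate of convergence *)

Theorem theorem3 (R : realType) (n : nat) (K : set 'rV[R]_n)
    (L : {linear 'rV[R]_n -> 'rV[R]_n}) (xstar : 'rV[R]_n) :
  polytope K -> K !=set0 ->
  (exists2 mu : R, 0 < mu &
     forall h, tangent_space K h -> mu * enorm h ^+ 2 <= dotp (L h) h) ->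
  relint K xstar ->
  exists C : R, forall a : 'rV[R]_n,
    vi_solution (fun x => L x + a) K xstar ->
    forall (delta : nat -> R) (x s : nat -> 'rV[R]_n),
    (forall k, 0 <= delta k) ->
    has_ubound (weighted_errors delta) ->
    fw_trajectory (fun x => L x + a) K delta x s ->
    (forall k : nat, (1 <= k)%N ->
       enorm (x k - xstar) <= C * (1 + sup (weighted_errors delta)) / k%:R) /\
    ((forall k, delta k = 0) -> forall k : nat, (1 <= k)%N ->
       enorm (x k - xstar) <= C / k%:R).
Proof.
move=> pK _ [mu mu0 mono] ri; have [Kxs _] := ri.
have [rho rho0 refl] := relint_reflect ri.
have [l l0 Lbound] := bilinear_bound L.
have [F /finite_seqP[fs FE] KE] := pK.
have Kfs z : z \in fs -> K z by move=> zfs; rewrite KE; apply: sub_conv_hull; rewrite FE.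
have vfs z : vert K z -> z \in fs.
  by rewrite KE => /vert_conv_hull; rewrite FE.
pose M (p q : seq_sub fs) : R := dotp (L (ssval p - xstar)) (ssval q - xstar).
pose D := \sum_p \sum_q `|M p q|.
have D0 : 0 <= D by apply: sumr_ge0 => p _; apply: sumr_ge0.
have MD p q : `|M p q| <= D.
  rewrite /D (bigD1 p) //= (bigD1 q) //= -addrA lerDl addr_ge0 ?sumr_ge0 //.
  by move=> i _; apply: sumr_ge0.
pose kappa := mu * rho.
have kappa0 : 0 < kappa by rewrite mulr_gt0.
(* The ratio kappa / (4 * l) bounds the mean of the directions played from
   below: one factor 2 comes from scores being at least half of the lead, the
   other from kappa |y| <= lead + E <= 2 lead. *)
pose c := mu * (kappa / (4 * l)) ^+ 2.
have c0 : 0 < c by rewrite mulr_gt0 // exprn_gt0 // divr_gt0 //; lra.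
have [P P0 bounded] := bounded_lead c0 D0 MD.
exists ((P + 1) / kappa) => a vi delta x s delta0 ub tr.
set B := sup _.
have main k : (1 <= k)%N -> enorm (x k - xstar) <= (P + 1) / kappa * (1 + B) / k%:R.
  have B_ge k' : k'%:R * delta k' <= B.
    have B_ge1 j : (1 <= j)%N -> j%:R * delta j <= B.
      by move=> j1; apply: ub_le_sup => //; exists j.
    case: k' => [|k']; last exact: B_ge1.
    by rewrite mul0r; apply: le_trans (B_ge1 1%N _); rewrite // mul1r.
  have B0 : 0 <= B by have := B_ge 0%N; rewrite mul0r.
  have Ks j : K (s j) by have [[]] := tr.2 j.
  have sfs j : s j \in fs by apply: vfs; have [] := tr.2 j.
  pose lab j := SeqSub (sfs j).
  pose y j := \sum_(0 <= i < j) (s i - xstar).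
  have scoreE j z : score M lab j z = - dotp (L (y j)) (ssval z - xstar).
    by rewrite /score /y linear_sum /= dotp_suml.
  have leadE j : lead M lab j = - dotp (L (y j)) (s j - xstar) by rewrite /lead scoreE.
  have greedy j z : K z -> - dotp (L (y j)) (z - xstar) <= lead M lab j + (1 + B).
    move=> Kz; have := trajectory_greedy j pK ri vi tr Kz.
    by rewrite leadE -/(y j); have := B_ge j; lra.
  have y_le j : kappa * enorm (y j) <= lead M lab j + (1 + B).
    have [y0|y0] := eqVneq (enorm (y j)) 0.
      rewrite y0 mulr0; have := greedy j xstar Kxs.
      by rewrite subrr dotpC dotp0l oppr0.
    have yp : 0 < enorm (y j) by rewrite lt_neqAle eq_sym y0 enorm_ge0.
    have Kz : K (xstar - (rho / enorm (y j)) *: y j).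
      apply: refl => //; rewrite ger0_norm ?divr_ge0 ?enorm_ge0 ?(ltW rho0) //.
      by rewrite mulfVK.
    have := greedy j _ Kz; rewrite addrC addKr dotpNr opprK dotpZr; apply: le_trans.
    have -> : kappa * enorm (y j) = rho / enorm (y j) * (mu * enorm (y j) ^+ 2).
      by rewrite /kappa; field.
    by rewrite ler_wpM2l ?divr_ge0 ?enorm_ge0 ?(ltW rho0) //; apply/mono/tangent_sum.
  have pl : play M c (1 + B) lab.
    split=> [j z|j b t bt leadj near].
      by rewrite scoreE; apply/greedy/Kfs/ssvalP.
    pose U := \sum_(b <= i < t) (s i - xstar).
    have -> : \sum_(b <= i < t) \sum_(b <= i' < t) M (lab i) (lab i') = dotp (L U) U.
      rewrite /U linear_sum /= dotp_suml; apply: eq_bigr => i _.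
      by rewrite dotp_sumr.
    have sumU : (t - b)%:R * (lead M lab j / 2) <= - dotp (L (y j)) U.
      rewrite /U dotp_sumr -sumrN mulr_natl -sumr_const_nat.
      by apply: ler_sum_nat => i /near; rewrite scoreE.
    have := mono U (tangent_sum b t Ks Kxs); apply: le_trans.
    rewrite /c -mulrA ler_pM2l // -exprMn.
    rewrite ler_pXn2r ?nnegrE ?enorm_ge0 //; last first.
      by rewrite mulr_ge0 // divr_ge0 //; lra.
    rewrite mulrAC ler_pdivrMr; last lra.
    have N0 : 0 <= (t - b)%:R :> R by [].
    have lead0 : 0 < lead M lab j by lra.
    rewrite -(ler_pM2r lead0).
    have H : (t - b)%:R * (lead M lab j / 2) <= l * enorm (y j) * enorm U.
      by apply: le_trans sumU (le_trans (ler_norm _) _); rewrite normrN.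
    (* |y j| is at most 2 lead / kappa, so it cancels against the lead in H. *)
    have y2 : kappa * enorm (y j) <= 2 * lead M lab j by have := y_le j; lra.
    have := ler_wpM2l (ltW kappa0) H.
    have := ler_wpM2l (mulr_ge0 (ltW l0) (enorm_ge0 U)) y2.
    nra.
  move=> k1.
  have k0 : 0 < k%:R :> R by rewrite ltr0n.
  have E1 : 1 <= 1 + B by lra.
  have := bounded lab (1 + B) E1 pl k.
  have := y_le k; rewrite /y -(trajectory_sum xstar k tr) enormZ gtr0_norm // => H1 H2.
  rewrite ler_pdivlMr // mulrAC ler_pdivlMr //; lra.
split=> // delta_0 k k1.
suff B0 : B = 0 by have := main k k1; rewrite B0 addr0 mulr1.
rewrite /B; have -> : weighted_errors delta = [set 0].
  apply/seteqP; split=> [_ [j _ <-]|_ ->]; first by rewrite delta_0 mulr0.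
  by exists 1%N; rewrite //= delta_0 mulr0.
exact: sup1.
Qed.
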